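(* Let $I\subset R=K[x_1,\ldots,x_n]$ be a monomial ideal minimally generated by $x^{v_1},\ldots,x^{v_q}$ ($q\ge 1$), let $A$ be the $n\times q$ matrix with columns $v_1,\ldots,v_q$, let $\mathbb{R}_+\mathcal{A}'\subset\mathbb{R}^{n+1}$ be the Rees cone of $I$, let $Q(A)=\{x\in\mathbb{R}^n \mid x\ge 0,\ xA\ge \mathbf{1}\}$, and let $V$ be the vertex set of $Q(A)$. Put $\mathcal{J}=\{1\le i\le n \mid \langle e_i,v_j\rangle=0 \text{ for some } j\}\cup\{n+1\}$. Then $$\mathbb{R}_+\mathcal{A}'=\left(\bigcap_{i\in\mathcal{J}}H^+_{e_i}\right)\cap\left(\bigcap_{\alpha\in V}H^+_{(\alpha,-1)}\right)$$ is the irreducible representation of the Rees cone of $I$; that is, the equality holds and none of the closed half-spaces $H^+_{e_i}$ ($i\in\mathcal{J}$), $H^+_{(\alpha,-1)}$ ($\alpha\in V$) can be omitted from the intersection.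
   Context: $K$ is a field and $R=K[x_1,\ldots,x_n]$ is a polynomial ring; for $a=(a_1,\ldots,a_n)\in\mathbb{N}^n$ (with $0\in\mathbb{N}$), $x^a=x_1^{a_1}\cdots x_n^{a_n}$. The vectors $v_1,\ldots,v_q\in\mathbb{N}^n$ are the exponent vectors of the minimal monomial generators of $I$ (no assumption that $A$ is a $\{0,1\}$-matrix). $\langle\,,\,\rangle$ is the usual inner product, $\mathbf{1}=(1,\ldots,1)$, and $e_i$ is the $i$th unit vector (of $\mathbb{R}^n$ or $\mathbb{R}^{n+1}$, according to context). In $xA\ge\mathbf{1}$ the vector $x$ is a row vector and inequalities are componentwise. The Rees cone $\mathbb{R}_+\mathcal{A}'$ of $I$ is the set of non-negative real linear combinations of $\mathcal{A}'=\{e_1,\ldots,e_n,(v_1,1),\ldots,(v_q,1)\}\subset\mathbb{R}^{n+1}$. For $0\ne c\in\mathbb{R}^{n+1}$, $H_c^+=\{x\in\mathbb{R}^{n+1}\mid\langle x,c\rangle\ge 0\}$. A representation of a cone as a finite intersection of closed half-spaces $H_{c_1}^+\cap\cdots\cap H_{c_s}^+$ is called irreducible if none of the half-spaces $H_{c_1}^+,\ldots,H_{c_s}^+$ can be omitted from the intersection. A vertex of $Q(A)$ is a point $x_0$ such that $\{x_0\}$ is a proper face of $Q(A)$ (i.e. an extreme point). *)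

(* Defs.v *)
From HB Require Import structures.
From mathcomp Require Import all_boot all_order all_algebra.
From mathcomp Require Import mpoly.
From mathcomp Require Import boolp classical_sets cardinality reals.

Set Implicit Arguments.
Unset Strict Implicit.
Unset Printing Implicit Defensive.

Import Order.TTheory GRing.Theory Num.Theory.

Local Open Scope classical_set_scope.
Local Open Scope ring_scope.

(* The ideal of K[x_1, ..., x_n] generated by the monomials x^(v_j), j in S. *)
Definition monomial_ideal (K : fieldType) (n q : nat)
    (v : 'I_q -> 'X_{1..n}) (S : {set 'I_q}) : set {mpoly K[n]} :=
  [set p | exists a : 'I_q -> {mpoly K[n]}, p = \sum_(j in S) a j * 'X_[v j]].

(* In particular the v_j are pairwise distinct: a repeated generator could be
   dropped. *)
Definition minimally_generated (K : fieldType) (n q : nat)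
    (I : set {mpoly K[n]}) (v : 'I_q -> 'X_{1..n}) : Prop :=
  I = monomial_ideal v ([set: 'I_q]%SET) /\
  forall S : {set 'I_q}, I = monomial_ideal v S -> S = [set: 'I_q]%SET.

Section Polyhedra.
Variable R : realType.

Definition inner (m : nat) (x y : 'rV[R]_m) : R := \sum_i x 0 i * y 0 i.

Definition unit_vec (m : nat) (i : 'I_m) : 'rV[R]_m := delta_mx 0 i.

(* H_c^+ *)
Definition halfspace (m : nat) (c : 'rV[R]_m) : set 'rV[R]_m :=
  [set x | 0 <= inner x c].

Definition cone_hull (m : nat) (S : set 'rV[R]_m) : set 'rV[R]_m :=
  [set x | exists (k : nat) (w : 'I_k -> 'rV[R]_m) (a : 'I_k -> R),
     [/\ forall i, S (w i), forall i, 0 <= a i & x = \sum_i a i *: w i]].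

(* Nonempty, not the whole of Q, and cut out by a supporting hyperplane. *)
Definition proper_face (m : nat) (Q F : set 'rV[R]_m) : Prop :=
  [/\ F !=set0, F <> Q &
    exists (c : 'rV[R]_m) (b : R),
      [/\ c != 0, Q `<=` [set x | b <= inner x c] &
          F = Q `&` [set x | inner x c = b]]].

Definition vertices (m : nat) (Q : set 'rV[R]_m) : set 'rV[R]_m :=
  [set x0 | proper_face Q [set x0]].

(* C is the intersection of the finitely many closed half-spaces H_c^+, c in N,
   and none of them can be omitted. *)
Definition irreducible_representation (m : nat) (C N : set 'rV[R]_m) : Prop :=
  [/\ finite_set N, forall c, N c -> c != 0,
      C = \bigcap_(c in N) halfspace c &
      forall c, N c -> C <> \bigcap_(c' in N `\ c) halfspace c'].

Section Rees.
Variables (n q : nat) (v : 'I_q -> 'X_{1..n}).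

Definition expvec (j : 'I_q) : 'rV[R]_n := \row_i (v j i)%:R.

Definition expmx : 'M[R]_(n, q) := \matrix_(i, j) (v j i)%:R.

(* (y, t) in R^(n+1) *)
Definition extend (y : 'rV[R]_n) (t : R) : 'rV[R]_(n + 1) :=
  row_mx y (const_mx t).

Definition rees_generators : set 'rV[R]_(n + 1) :=
  [set unit_vec (lshift 1 i) | i in [set: 'I_n]] `|`
  [set extend (expvec j) 1 | j in [set: 'I_q]].

Definition rees_cone : set 'rV[R]_(n + 1) := cone_hull rees_generators.

Definition covering_polyhedron : set 'rV[R]_n :=
  [set x : 'rV[R]_n | (forall i, 0 <= x 0 i) /\ (forall j, 1 <= (x *m expmx) 0 j)].

(* rshift n ord0 is the last index, n+1 in 1-based numbering. *)
Definition rees_index : set 'I_(n + 1) :=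
  [set lshift 1 i | i in
     [set i : 'I_n | exists j, inner (unit_vec i) (expvec j) = 0]] `|`
  [set rshift n ord0].

End Rees.
End Polyhedra.

Arguments rees_generators R [n q] v.
Arguments rees_cone R [n q] v.
Arguments covering_polyhedron R [n q] v.

(* Main.v *)
(** Farkas' lemma (by Bartl's induction on the number of generators) reduces the
    inclusion of the intersection in the Rees cone to the following: if [y] and
    [t] are non-negative and [t <= <y, alpha>] for every vertex [alpha] of
    [Q(A)], then [t <= <y, d>] for every [d] in [Q(A)].  This holds because a
    point of [Q(A)] whose set of tight constraints does not determine it can be
    moved, without increasing [<y, .>], until one more constraint is tight.

    Non-redundancy is witnessed by explicit points: [- e_(n+1)] for the last
    coordinate, [(v_j, 1/2) - eps e_i] for [e_i] when [<e_i, v_j> = 0], and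
    [(c, <c, alpha> + eps)] for a vertex [alpha] exposed by [c]. *)

Require Import Defs.
From mathcomp Require Import all_boot all_order all_algebra.
From mathcomp Require Import mpoly.
From mathcomp Require Import boolp classical_sets cardinality reals.
From mathcomp Require Import lra.

Set Implicit Arguments.
Unset Strict Implicit.
Unset Printing Implicit Defensive.

Import Order.TTheory GRing.Theory Num.Theory.

Local Open Scope classical_set_scope.
Local Open Scope ring_scope.

(** * The inner product *)

Section Inner.
Variables (R : realType) (m : nat).
Implicit Types (x y z : 'rV[R]_m) (a : R) (S : set 'rV[R]_m).

Lemma innerC x y : inner x y = inner y x.
Proof. by apply: eq_bigr => i _; rewrite mulrC. Qed.

Lemma innerDl x y z : inner (x + y) z = inner x z + inner y z.
Proof. by rewrite -big_split; apply: eq_bigr => i _; rewrite mxE mulrDl. Qed.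

Lemma innerZl a x z : inner (a *: x) z = a * inner x z.
Proof. by rewrite mulr_sumr; apply: eq_bigr => i _; rewrite mxE mulrA. Qed.

Lemma innerNl x z : inner (- x) z = - inner x z.
Proof. by rewrite -scaleN1r innerZl mulN1r. Qed.

Lemma innerBl x y z : inner (x - y) z = inner x z - inner y z.
Proof. by rewrite innerDl innerNl. Qed.

Lemma innerDr x y z : inner z (x + y) = inner z x + inner z y.
Proof. by rewrite innerC innerDl !(innerC z). Qed.

Lemma innerZr a x z : inner z (a *: x) = a * inner z x.
Proof. by rewrite innerC innerZl (innerC z). Qed.

Lemma inner0l x : inner 0 x = 0.
Proof. by rewrite -(scale0r x) innerZl mul0r. Qed.

Lemma inner_suml (I : Type) (r : seq I) (P : pred I) (F : I -> 'rV[R]_m) y :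
  inner (\sum_(i <- r | P i) F i) y = \sum_(i <- r | P i) inner (F i) y.
Proof.
apply: (big_morph (fun x => inner x y)) => [x x'|]; first exact: innerDl.
exact: inner0l.
Qed.

Lemma inner_sumr (I : Type) (r : seq I) (P : pred I) (F : I -> 'rV[R]_m) y :
  inner y (\sum_(i <- r | P i) F i) = \sum_(i <- r | P i) inner y (F i).
Proof. by rewrite innerC inner_suml; apply: eq_bigr => i _; rewrite innerC. Qed.

Lemma inner_unit x i : inner x (unit_vec R i) = x 0 i.
Proof.
rewrite /inner (bigD1 i) //= big1 => [|k ki]; rewrite mxE eqxx /=.
  by rewrite eqxx mulr1 addr0.
by rewrite (negbTE ki) mulr0.
Qed.

Lemma inner_ge0 x y :
  (forall i, 0 <= x 0 i) -> (forall i, 0 <= y 0 i) -> 0 <= inner x y.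
Proof. by move=> x0 y0; apply: sumr_ge0 => i _; apply: mulr_ge0. Qed.

(** Chooses the sign of a line's direction so that moving along it does not increase [inner _ z] and
    lowers some coordinate. If [inner d z <= 0] but [d] has no negative entry, then [- d] serves,
    because [z] is non-negative. *)
Lemma nonpos_direction d z : d != 0 -> (forall i, 0 <= z 0 i) ->
  exists e, [/\ e = d \/ e = - d, inner e z <= 0 & exists i, e 0 i < 0].
Proof.
move=> d0 z0; wlog dz : d d0 / inner d z <= 0.
  move=> H; have [/H//|dz] := leP (inner d z) 0; first exact.
  have [||e [ed ez ei]] := H (- d); first by rewrite oppr_eq0.
    by rewrite innerNl oppr_le0 ltW.
  by exists e; split=> //; rewrite opprK in ed; case: ed; [right|left].
case: (pselect (exists i, d 0 i < 0)) => [di|npos].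
  by exists d; split=> //; left.
have d_ge0 i : 0 <= d 0 i.
  by rewrite leNgt; apply/negP => di; apply: npos; exists i.
exists (- d); split; first by right.
  by rewrite innerNl oppr_le0 inner_ge0.
have /rV0Pn [i di] := d0; exists i.
by rewrite mxE oppr_lt0 lt_neqAle eq_sym di d_ge0.
Qed.

End Inner.

(** * Conical hulls and Farkas' lemma *)

Section ConeHull.
Variables (R : realType) (m : nat).
Implicit Types (x y : 'rV[R]_m) (a : R) (S : set 'rV[R]_m).

Lemma cone_hull_mem S x : S x -> cone_hull S x.
Proof.
move=> Sx; exists 1%N, (fun=> x), (fun=> 1); split=> //.
by rewrite big_ord1 scale1r.
Qed.

Lemma cone_hull0 S : cone_hull S 0.
Proof. by exists 0%N, (fun=> 0), (fun=> 0); split=> [[]|[]|] //; rewrite big_ord0. Qed.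

Lemma cone_hullD S x y : cone_hull S x -> cone_hull S y -> cone_hull S (x + y).
Proof.
move=> [k [w [a [Sw a0 ->]]]] [l [w' [a' [Sw' a0' ->]]]].
exists (k + l)%N, (fun i => match split i with inl j => w j | inr j => w' j end),
  (fun i => match split i with inl j => a j | inr j => a' j end).
split=> [i|i|]; try by case: split.
rewrite big_split_ord /=; congr (_ + _); apply: eq_bigr => i _.
  by rewrite (unsplitK (inl i)).
by rewrite (unsplitK (inr i)).
Qed.

Lemma cone_hullZ S a x : 0 <= a -> cone_hull S x -> cone_hull S (a *: x).
Proof.
move=> a0 [k [w [b [Sw b0 ->]]]]; exists k, w, (fun i => a * b i).
split=> // [i|]; first exact: mulr_ge0.
by rewrite scaler_sumr; apply: eq_bigr => i _; rewrite scalerA.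
Qed.

Lemma cone_hull_sub S S' : S `<=` cone_hull S' -> cone_hull S `<=` cone_hull S'.
Proof.
move=> SS' _ [k [w [a [Sw a0 ->]]]].
apply: (big_ind (cone_hull S')) => [|x y|i _]; first exact: cone_hull0.
  exact: cone_hullD.
by apply: cone_hullZ => //; apply: SS'.
Qed.

(** If dropping the generator [a] breaks the hypothesis, some [c0] is non-negative on [s] and
    negative at [y], hence also at [a]. Projecting along [a] onto the hyperplane orthogonal to [c0]
    reduces to the shorter list, and undoing the projection only adds non-negative multiples of
    [a]. *)
Lemma farkas (s : seq 'rV[R]_m) y :
  (forall c, (forall x, x \in s -> 0 <= inner x c) -> 0 <= inner y c) ->
  cone_hull [set` s] y.
Proof.
have [k] := ubnP (size s); elim: k => // k IH in s y *.
case: s => [_ hy|a s /= ltsk hy].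
  (* With no generators every [c] is a valid test, and testing with both signs of each unit vector
     gives [y = 0]. *)
  suff -> : y = 0 by exact: cone_hull0.
  apply/rowP => i; rewrite mxE; apply/eqP; rewrite eq_le.
  have /(_ (fun _ => ltac:(by []))) := hy (unit_vec R i).
  have /(_ (fun _ => ltac:(by []))) := hy (- 1 *: unit_vec R i).
  by rewrite innerZr inner_unit mulN1r oppr_ge0 => -> ->.
case: (pselect (forall c, (forall x, x \in s -> 0 <= inner x c) ->
    0 <= inner y c)) => [hys|].
  apply: (cone_hull_sub _ (IH s y ltsk hys)) => x /= xs.
  by apply: cone_hull_mem; rewrite /= inE xs orbT.
move=> /existsNP [c0 /not_implyP [c0s /negP]]; rewrite -ltNge => yc0.
have ac0 : inner a c0 < 0.
  rewrite ltNge; apply/negP => ac0; move: yc0; rewrite ltNge hy // => x.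
  by rewrite inE => /orP[/eqP ->|/c0s].
pose c := (- inner a c0)^-1 *: c0.
have t0 : 0 < (- inner a c0)^-1 by rewrite invr_gt0 oppr_gt0.
have ac : inner a c = -1.
  by rewrite innerZr invrN mulNr mulVf // lt_eqF.
have cs x : x \in s -> 0 <= inner x c.
  by move=> xs; rewrite innerZr mulr_ge0 ?c0s // ltW.
have yc : inner y c < 0 by rewrite innerZr pmulr_rlt0.
(* Since [inner a c = -1], this is the projection along [a] onto the hyperplane orthogonal to
   [c]. *)
pose proj x := x + inner x c *: a.
have mem_a : cone_hull [set` a :: s] a.
  by apply: cone_hull_mem; rewrite /= mem_head.
have -> : y = proj y + (- inner y c) *: a by rewrite scaleNr addrK.
apply: cone_hullD; last by apply: cone_hullZ => //; rewrite oppr_ge0 ltW.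
have hproj : cone_hull [set` map proj s] (proj y).
  apply: IH => [|d hd]; first by rewrite size_map.
  (* The adjoint of [proj] turns [d] into a vector orthogonal to [a], so the hypothesis on [a :: s]
     applies to it. *)
  have projE x : inner (proj x) d = inner x (d + inner a d *: c).
    by rewrite innerDl innerDr innerZl (innerZr (inner a d) c) mulrC.
  rewrite projE; apply: hy => x; rewrite inE => /orP[/eqP ->|xs].
    by rewrite innerDr (innerZr (inner a d) c) ac mulrN1 subrr.
  by rewrite -projE hd // map_f.
apply: (cone_hull_sub _ hproj) => _ /= /mapP [x xs ->].
apply: cone_hullD; last by apply: cone_hullZ => //; apply: cs.
by apply: cone_hull_mem; rewrite /= inE xs orbT.
Qed.

End ConeHull.

(** * Tight constraints and vertices of polyhedra *)

Section Vertices.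
Variables (R : realType) (m : nat).
Implicit Types (x y z : 'rV[R]_m).

Lemma vertices_sub (Q : set 'rV[R]_m) : vertices Q `<=` Q.
Proof. by move=> x [_ _ [c [b [_ _ /seteqP[+ _]]]]] => /(_ x erefl) []. Qed.

Lemma vertex_exposed (Q : set 'rV[R]_m) x : vertices Q x ->
  exists c : 'rV[R]_m, forall y, Q y -> y <> x -> inner x c < inner y c.
Proof.
move=> [_ _ [c [b [_ Qb xE]]]]; exists c => y Qy yx.
have xb : inner x c = b by move/seteqP: xE => [/(_ x erefl) []].
rewrite lt_neqAle xb (Qb _ Qy : b <= _) andbT; apply/eqP => yb.
by apply: yx; move/seteqP: xE => [_]; apply; split.
Qed.

Variables (T : finType) (a : T -> 'rV[R]_m) (b : T -> R).

Let P : set 'rV[R]_m := [set x | forall k, b k <= inner x (a k)].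

Definition tight x : {set T} := [set k | inner x (a k) == b k].

Lemma tightP x k : reflect (inner x (a k) = b k) (k \in tight x).
Proof. by rewrite inE; apply: eqP. Qed.

(* Moving [x] along [d] until the first new constraint becomes tight. *)
Lemma polyhedron_ray x d :
  P x -> (forall k, k \in tight x -> inner d (a k) = 0) ->
  (exists k, inner d (a k) < 0) ->
  exists s, [/\ 0 <= s, P (x + s *: d) & tight x \proper tight (x + s *: d)].
Proof.
move=> Px xd [k0 dk0].
(* Ratio test: the step length at which a constraint decreasing along [d] becomes tight. *)
pose r k := (inner x (a k) - b k) / - inner d (a k).
case: (@arg_minP _ _ _ k0 (fun k => inner d (a k) < 0) r dk0) => k dk kmin.
have r0 l : inner d (a l) < 0 -> 0 <= r l.
  by move=> dl; rewrite divr_ge0 ?subr_ge0 ?Px // oppr_ge0 ltW.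
have rd l : inner d (a l) < 0 -> r l * inner d (a l) = b l - inner x (a l).
  move=> dl; rewrite -[inner d _ in X in X = _]opprK mulrN divfK ?opprB //.
  by rewrite oppr_eq0 lt_eqF.
exists (r k); split; first exact: r0.
- move=> l; rewrite innerDl innerZl.
  have [dl|dl] := ltP (inner d (a l)) 0; last first.
    by apply: (le_trans (Px l)); rewrite lerDl mulr_ge0 // r0.
  rewrite -lerBlDl -rd // ler_wnM2r ?(ltW dl) //; exact: kmin.
apply/properP; split.
  apply/fintype.subsetP => l xl; apply/tightP; rewrite innerDl innerZl (xd _ xl).
  by rewrite mulr0 addr0; apply/tightP.
exists k; first by apply/tightP; rewrite innerDl innerZl rd // subrKC.
by apply/negP => /xd dk'; rewrite dk' ltxx in dk.
Qed.

(** The sum of the tight normals exposes [x]: a point of [P] minimising this sum makes each summand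
    minimal, so it is tight wherever [x] is. *)
Lemma vertex_tight x : P x -> P <> [set x] ->
  (forall y, P y -> tight x \subset tight y -> y = x) -> vertices P x.
Proof.
move=> Px Px1 uniq; split=> //; first by exists x.
  exact: nesym.
pose c := \sum_(k in tight x) a k; pose t := \sum_(k in tight x) b k.
have xc : inner x c = t.
  by rewrite inner_sumr; apply: eq_bigr => k /tightP.
have ct : P `<=` [set y | t <= inner y c].
  by move=> y Py /=; rewrite inner_sumr; apply: ler_sum => k _; apply: Py.
have Fx y : P y -> inner y c = t -> y = x.
  move=> Py yc; apply: uniq => //; apply/fintype.subsetP => k kx; apply/tightP.
  apply/eqP; rewrite -subr_eq0; apply/eqP.
  have /psumr_eq0P : forall k, k \in tight x -> 0 <= inner y (a k) - b k.
    by move=> l _; rewrite subr_ge0.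
  by apply=> //; rewrite sumrB -inner_sumr -/c yc subrr.
exists c, t; split=> //.
  (* If the sum of the tight normals were zero, all of [P] would minimise it, so [P] would be the
     single point [x]. *)
  apply: contra_notN Px1 => /eqP c0; apply/seteqP; split=> [y Py|_ ->//].
  by apply: Fx => //; rewrite -xc c0 !(innerC _ 0) !inner0l.
by apply/seteqP; split=> [_ ->//|y [Py yc]]; apply: Fx.
Qed.

(** This makes the vertices finite in number. If [x] and [y] had the same tight set, one could
    continue from [x] a little in the direction [x - y] inside [P], which would lower the functional
    that exposes [x]. *)
Lemma vertices_tight_inj : {in vertices P &, injective tight}.
Proof.
move=> x y; rewrite !inE => Vx Vy xy; apply: contrapT => nxy.
have [Px Py] := (vertices_sub Vx, vertices_sub Vy).
have [c cx] := vertex_exposed Vx.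
have dc : inner (x - y) c < 0.
  by rewrite innerBl subr_lt0; apply: cx => //; apply: nesym.
have beyond s : 0 < s -> ~ P (x + s *: (x - y)).
  move=> s0 Ps; have sdc : inner (x + s *: (x - y)) c < inner x c.
    by rewrite innerDl innerZl gtrDl pmulr_rlt0.
  have /(cx _ Ps) : x + s *: (x - y) <> x by move=> xE; rewrite xE ltxx in sdc.
  by rewrite ltNge ltW.
case: (pselect (exists k, inner (x - y) (a k) < 0)) => [dneg|dpos].
  have [k xk|s [s0 Ps]] := @polyhedron_ray x (x - y) Px _ dneg.
    have yk : k \in tight y by rewrite -xy.
    by rewrite innerBl (tightP _ _ xk) (tightP _ _ yk) subrr.
  (* A zero step would leave the tight set unchanged, but it has grown. *)
  move: s0; rewrite le0r => /orP[/eqP ->|/beyond //].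
  by rewrite scale0r addr0 fintype.properxx.
apply: (beyond 1) => // k; rewrite scale1r innerDl.
apply: (le_trans (Px k)); rewrite lerDl leNgt; apply/negP => dk.
by apply: dpos; exists k.
Qed.

Lemma finite_vertices_polyhedron : finite_set (vertices P).
Proof. by rewrite -(eq_finite_set (inj_card_eq vertices_tight_inj)). Qed.

(** Induction on the number of constraints that are not tight at [x]. As the coordinates occur among
    the constraints, a direction with a negative entry must reach a new one. *)
Lemma polyhedron_vertex_below z x :
  (forall i, exists k, a k = unit_vec R i) -> (forall y, P <> [set y]) ->
  (forall i, 0 <= z 0 i) -> P x ->
  exists2 y, vertices P y & inner y z <= inner x z.
Proof.
move=> coord P1 z0; have [k] := ubnP #|~: tight x|; elim: k => // k IH in x *.
move=> ltk Px.
case: (pselect (exists y, [/\ P y, tight x \subset tight y & y <> x])); last first.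
  move=> uniq; exists x => //; apply: vertex_tight => // y Py xy.
  by apply: contrapT => yx; apply: uniq; exists y.
move=> [y [Py xy /eqP]]; rewrite -subr_eq0 => yx.
(* Either sign of [y - x] keeps the tight constraints of [x] tight, since they are tight at [y]
   too. *)
have [d [dE dz [i di]]] := nonpos_direction yx z0.
have dt l : l \in tight x -> inner d (a l) = 0.
  move=> xl; have yl := fintype.subsetP xy _ xl.
  by case: dE => ->; rewrite ?innerNl innerBl (tightP _ _ xl) (tightP _ _ yl)
    subrr ?oppr0.
have [|s [s0 Ps ts]] := polyhedron_ray Px dt.
  by have [l al] := coord i; exists l; rewrite al inner_unit.
have [|w Vw wz] := IH (x + s *: d) _ Ps.
  rewrite -ltnS; apply: leq_trans ltk; rewrite ltnS; apply: proper_card.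
  by rewrite -properC !finset.setCK.
exists w => //; apply: (le_trans wz).
by rewrite innerDl innerZl gerDl mulr_ge0_le0.
Qed.

End Vertices.

(** Supplies the small positive constants in the witnesses of non-redundancy. *)
Lemma finite_pos_lower_bound (R : realType) (T : choiceType) (A : set T) (f : T -> R) :
  finite_set A -> (forall x, A x -> 0 < f x) ->
  exists2 e, 0 < e & forall x, A x -> e <= f x.
Proof.
move=> /finite_seqP [s ->]; elim: s => [|x s IH] f0; first by exists 1.
have [y ys|e e0 es] := IH; first by apply: f0; rewrite /= inE (ys : y \in s) orbT.
exists (Num.min e (f x)); first by rewrite lt_min e0 f0 //= mem_head.
move=> y /=; rewrite inE ge_min => /orP[/eqP ->|/es ->//].
by rewrite lexx orbT.
Qed.

(** * The covering polyhedron *)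

Section ReesCone.
Variables (R : realType) (n q : nat) (v : 'I_q -> 'X_{1..n}).
Hypothesis q_gt0 : (1 <= q)%N.
Implicit Types (x y d : 'rV[R]_n) (t s : R).

Let Q := covering_polyhedron R v.
Let V := vertices Q.
Let J := rees_index R v.

Definition covering_normal (k : 'I_n + 'I_q) : 'rV[R]_n :=
  match k with inl i => unit_vec R i | inr j => expvec R v j end.

Definition covering_rhs (k : 'I_n + 'I_q) : R := if k is inl _ then 0 else 1.

Lemma covering_polyhedronE :
  Q = [set x | forall k, covering_rhs k <= inner x (covering_normal k)].
Proof.
have mxE' x j : (x *m expmx R v) 0 j = inner x (expvec R v j).
  by rewrite mxE; apply: eq_bigr => i _; rewrite !mxE.
apply/seteqP; split=> [x [x0 x1]|x xQ] /=.
  by case=> [i|j] /=; rewrite ?inner_unit -?mxE'.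
split=> [i|j]; first by have := xQ (inl i); rewrite /= inner_unit.
by rewrite mxE'; apply: (xQ (inr j)).
Qed.

Lemma coveringP x :
  Q x <-> (forall i, 0 <= x 0 i) /\ (forall j, 1 <= inner x (expvec R v j)).
Proof.
rewrite covering_polyhedronE; split=> [xQ|[x0 x1] [i|j]] /=; last 2 first.
- by rewrite inner_unit.
- exact: x1.
by split=> [i|j]; [have := xQ (inl i); rewrite /= inner_unit|exact: (xQ (inr j))].
Qed.

Lemma expvec_ge0 j i : 0 <= expvec R v j 0 i.
Proof. by rewrite mxE ler0n. Qed.

(** [Q] is closed upwards because the exponent vectors are non-negative. *)
Lemma covering_add_unit x i : Q x -> Q (x + unit_vec R i).
Proof.
move=> /coveringP [x0 x1]; have u0 k : 0 <= unit_vec R i 0 k.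
  by rewrite mxE ler0n.
apply/coveringP; split=> [k|j]; first by rewrite mxE addr_ge0.
by rewrite innerDl (le_trans (x1 j)) // lerDl inner_ge0 // => k; apply: expvec_ge0.
Qed.

Lemma unit_vec_neq0 (m : nat) (i : 'I_m) : unit_vec R i != 0.
Proof.
apply/eqP => /matrixP /(_ 0 i); rewrite !mxE !eqxx => /eqP.
by rewrite oner_eq0.
Qed.

(** Needed because a vertex must be a proper face. In dimension 0 a generator would impose [1 <= 0];
    otherwise adding a unit vector gives a second point. *)
Lemma covering_not_singleton x : Q <> [set x].
Proof.
move=> Qx; have xQ : Q x by rewrite Qx.
have : (0 < n)%N.
  rewrite lt0n; apply/eqP => n0; have [_ /(_ (Ordinal q_gt0))] := (coveringP x).1 xQ.
  rewrite /inner big1 ?ler10 // => i; have := ltn_ord i.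
  by rewrite [X in (_ < X)%N]n0.
move=> n0; have := covering_add_unit (Ordinal n0) xQ.
rewrite Qx /= => /eqP; rewrite -subr_eq0 addrC addKr.
by rewrite (negbTE (unit_vec_neq0 _)).
Qed.

Lemma covering_vertex_below y x : (forall i, 0 <= y 0 i) -> Q x ->
  exists2 alpha, V alpha & inner alpha y <= inner x y.
Proof.
rewrite /V => y0; have := covering_not_singleton.
rewrite covering_polyhedronE => Q1; apply: polyhedron_vertex_below => //.
by move=> i; exists (inl i).
Qed.

Lemma finite_covering_vertices : finite_set V.
Proof. by rewrite /V covering_polyhedronE; apply: finite_vertices_polyhedron. Qed.

(** * The Rees cone as an intersection of half-spaces *)

Lemma extendE (w : 'rV[R]_(n + 1)) : exists x t, w = extend x t.
Proof.
exists (lsubmx w), (w 0 (rshift n ord0)); rewrite -[LHS]hsubmxK; congr row_mx.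
by apply/rowP => k; rewrite !mxE ord1.
Qed.

Lemma inner_extend x y t s : inner (extend x t) (extend y s) = inner x y + t * s.
Proof.
rewrite /inner big_split_ord big_ord1; congr (_ + _).
  by apply: eq_bigr => i _; rewrite !row_mxEl.
by rewrite !row_mxEr !mxE.
Qed.

Lemma inner_extend_lunit x t i : inner (extend x t) (unit_vec R (lshift 1 i)) = x 0 i.
Proof. by rewrite inner_unit row_mxEl. Qed.

Lemma inner_extend_runit x t : inner (extend x t) (unit_vec R (rshift n ord0)) = t.
Proof. by rewrite inner_unit row_mxEr mxE. Qed.

Definition rees_constraints : set 'rV[R]_(n + 1) :=
  [set unit_vec R i | i in J] `|` [set extend alpha (-1) | alpha in V].

Lemma rees_constraintsE : \bigcap_(c in rees_constraints) halfspace c =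
  (\bigcap_(i in J) halfspace (unit_vec R i)) `&`
  (\bigcap_(alpha in V) halfspace (extend alpha (-1))).
Proof. by rewrite bigcap_setU !bigcap_image. Qed.

(** Stated for a subset [N] so that it applies after one normal has been removed. *)
Lemma rees_constraintsP (N : set 'rV[R]_(n + 1)) x t : N `<=` rees_constraints ->
  (forall i, (exists j, expvec R v j 0 i = 0) -> N (unit_vec R (lshift 1 i)) ->
    0 <= x 0 i) ->
  (N (unit_vec R (rshift n ord0)) -> 0 <= t) ->
  (forall alpha, V alpha -> N (extend alpha (-1)) -> t <= inner x alpha) ->
  (\bigcap_(c in N) halfspace c) (extend x t).
Proof.
move=> NC hl hr hV c Nc.
case: (NC _ Nc) => [[_ [[i [j ij] <-]|->]]|[alpha Va]] cE; rewrite -cE in Nc *;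
  rewrite /halfspace /=.
- rewrite inner_extend_lunit; apply: hl => //; exists j.
  by rewrite -inner_unit innerC.
- by rewrite inner_extend_runit; apply: hr.
- by rewrite inner_extend mulrN1 subr_ge0; apply: hV.
Qed.

Lemma rees_cone_sub : rees_cone R v `<=` \bigcap_(c in rees_constraints) halfspace c.
Proof.
move=> w hw c Cc; case: hw => k [g [a [hg a0 ->]]].
rewrite /halfspace /= inner_suml; apply: sumr_ge0 => l _; rewrite innerZl mulr_ge0 //.
have gen_ge0 : forall i, 0 <= g l 0 i.
  move=> i; case: (hg l) => [[i' _ <-]|[j _ <-]]; first by rewrite mxE ler0n.
  rewrite /extend -(splitK i); case: split => i' /=.
    by rewrite row_mxEl expvec_ge0.
  by rewrite row_mxEr mxE ler01.
case: Cc => [[i _ <-]|[alpha /vertices_sub /coveringP [al0 al1] <-]].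
  by rewrite inner_unit.
case: (hg l) => [[i _ <-]|[j _ <-]].
  by rewrite innerC inner_extend_lunit.
by rewrite inner_extend mul1r subr_ge0 innerC.
Qed.

(** The point is the case of [i] outside [J]. Then every generator involves the [i]-th variable, so
    [e_i] lies in [Q] and some vertex [alpha] is a positive multiple of [e_i]; its half-space gives
    [0 <= t <= x_i * alpha_i]. *)
Lemma rees_constraints_ge0 x t i :
  (\bigcap_(c in rees_constraints) halfspace c) (extend x t) -> 0 <= x 0 i.
Proof.
move=> xC; case: (pselect (exists j, expvec R v j 0 i = 0)) => [[j ij]|pos].
  rewrite -(inner_extend_lunit x t); apply: xC; left.
  exists (lshift 1 i) => //; left; exists i => //; exists j.
  by rewrite innerC inner_unit.
have t0 : 0 <= t.
  rewrite -(inner_extend_runit x t); apply: xC; left.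
  by exists (rshift n ord0) => //; right.
have pos1 j : 1 <= expvec R v j 0 i.
  rewrite mxE ler1n lt0n; apply/eqP => ij; apply: pos; exists j.
  by rewrite mxE ij.
have eiQ : Q (unit_vec R i).
  apply/coveringP; split=> [k|j]; first by rewrite mxE ler0n.
  by rewrite innerC inner_unit.
(* The vertex below [e_i] in the direction [sum_(k != i) e_k] lies on the
   [i]-th axis. *)
pose y : 'rV[R]_n := \row_k (k != i)%:R.
have [|alpha Va ay] := @covering_vertex_below y _ _ eiQ.
  by move=> k; rewrite mxE ler0n.
have /coveringP [al0 al1] := vertices_sub Va.
have al_i k : k != i -> alpha 0 k = 0.
  move=> ki; move: ay; rewrite [X in _ <= X]innerC inner_unit mxE eqxx /= => ay.
  have /eqP : inner alpha y = 0.
    apply/eqP; rewrite eq_le ay inner_ge0 // => l; by rewrite mxE ler0n.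
  rewrite psumr_eq0 => [/allP/(_ k (mem_index_enum _))|l _].
    by rewrite mxE ki mulr1 => /eqP.
  by rewrite mulr_ge0 // mxE ler0n.
have innera z : inner z alpha = z 0 i * alpha 0 i.
  by rewrite /inner (bigD1 i) //= big1 ?addr0 // => k ki; rewrite al_i ?mulr0.
(* Otherwise [alpha] would be zero and violate the constraint of the first generator. *)
have ai0 : 0 < alpha 0 i.
  rewrite lt_neqAle al0 andbT eq_sym; apply/eqP => ai.
  by have := al1 (Ordinal q_gt0); rewrite innerC innera ai mulr0 ler10.
have : 0 <= inner (extend x t) (extend alpha (-1)).
  by apply: xC; right; exists alpha.
rewrite inner_extend mulrN1 subr_ge0 innera => /(le_trans t0).
by rewrite pmulr_lge0.
Qed.

Lemma rees_constraints_sub :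
  \bigcap_(c in rees_constraints) halfspace c `<=` rees_cone R v.
Proof.
move=> w; have [x [t ->]] := extendE w => xC.
pose gens := [seq unit_vec R (lshift 1 i) | i <- enum 'I_n] ++
  [seq extend (expvec R v j) 1 | j <- enum 'I_q].
apply: (@cone_hull_sub _ _ [set` gens]) => [c /=|].
  rewrite mem_cat => /orP[/mapP [i _ ->]|/mapP [j _ ->]]; apply: cone_hull_mem.
    by left; exists i.
  by right; exists j.
apply: farkas => c; have [d [s ->]] := extendE c => hc.
have x0 i : 0 <= x 0 i by apply: rees_constraints_ge0 xC.
have t0 : 0 <= t.
  rewrite -(inner_extend_runit x t); apply: xC; left.
  by exists (rshift n ord0) => //; right.
have d0 i : 0 <= d 0 i.
  rewrite -(inner_extend_lunit d s) innerC; apply: hc.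
  by rewrite mem_cat (map_f (fun i => unit_vec R (lshift 1 i))) ?mem_enum.
have dv j : 0 <= inner d (expvec R v j) + s.
  rewrite -[s]mulr1 -inner_extend innerC; apply: hc.
  by rewrite mem_cat (map_f (fun j => extend (expvec R v j) 1)) ?mem_enum ?orbT.
(* Only a negative [s] needs the vertices: dividing [d] by [- s] then gives a point of [Q], and a
   vertex below it in the direction [x] bounds [t]. *)
rewrite inner_extend; have [s0|s0] := leP 0 s.
  by rewrite addr_ge0 ?inner_ge0 ?mulr_ge0.
have s1 : 0 < (- s)^-1 by rewrite invr_gt0 oppr_gt0.
have dQ : Q ((- s)^-1 *: d).
  apply/coveringP; split=> [i|j]; first by rewrite mxE mulr_ge0 // ltW.
  by rewrite innerZl mulrC ler_pdivlMr ?oppr_gt0 // mul1r -subr_ge0 opprK.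
have [alpha Va] := covering_vertex_below x0 dQ.
have : 0 <= inner (extend x t) (extend alpha (-1)) by apply: xC; right; exists alpha.
rewrite inner_extend mulrN1 subr_ge0 (innerC x alpha) => ta /(le_trans ta).
rewrite innerZl mulrC ler_pdivlMr ?oppr_gt0 // (innerC d).
by rewrite -subr_ge0 mulrN opprK.
Qed.

Lemma rees_coneE : rees_cone R v = \bigcap_(c in rees_constraints) halfspace c.
Proof. by apply/seteqP; split; [exact: rees_cone_sub|exact: rees_constraints_sub]. Qed.

(** * Non-redundancy of the half-spaces *)

Lemma rees_constraints_lunit_irredundant i j : expvec R v j 0 i = 0 ->
  exists2 w, inner w (unit_vec R (lshift 1 i)) < 0 &
    (\bigcap_(c in rees_constraints `\ unit_vec R (lshift 1 i)) halfspace c) w.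
Proof.
(* A lower bound [e] of [f] satisfies [e * alpha_i <= 1/2], so subtracting [e] times [e_i] from
   [v_j] keeps its product with [alpha] at least [1 - 1/2]. The summand 1 keeps the denominator
   positive when [alpha_i = 0]. *)
move=> ij; pose f (alpha : 'rV[R]_n) : R := 2^-1 / (1 + alpha 0 i).
have V0 alpha : V alpha -> 0 < 1 + alpha 0 i.
  by move=> /vertices_sub /coveringP [al0 _]; rewrite ltr_wpDr.
have [alpha Va|e e0 eV] := finite_pos_lower_bound (f := f) finite_covering_vertices.
  by rewrite divr_gt0 ?V0 ?invr_gt0.
exists (extend (expvec R v j - e *: unit_vec R i) 2^-1).
  rewrite inner_extend_lunit -inner_unit innerBl innerZl !inner_unit ij sub0r.
  by rewrite mxE !eqxx mulr1 oppr_lt0.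
apply: rees_constraintsP => [|k _ [_ ki]||alpha Va _]; first exact: subDsetl.
- have ki' : k == i = false by apply/eqP => kiE; apply: ki; rewrite kiE.
  by rewrite !mxE ki' andbF mulr0 subr0 ler0n.
- by rewrite invr_ge0.
have /coveringP [al0 al1] := vertices_sub Va.
have := eV _ Va; rewrite ler_pdivlMr ?V0 // => ea.
rewrite innerBl innerZl ![inner _ alpha]innerC inner_unit.
by have := al1 j; lra.
Qed.

Lemma rees_constraints_runit_irredundant :
  exists2 w, inner w (unit_vec R (rshift n ord0)) < 0 &
    (\bigcap_(c in rees_constraints `\ unit_vec R (rshift n ord0)) halfspace c) w.
Proof.
exists (extend 0 (-1)); first by rewrite inner_extend_runit oppr_lt0.
apply: rees_constraintsP => [|k _ _|[_ []]|alpha Va _]; first exact: subDsetl.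
- by rewrite mxE.
- by [].
- by rewrite inner0l lerN10.
Qed.

Lemma rees_constraints_vertex_irredundant alpha : V alpha ->
  exists2 w, inner w (extend alpha (-1)) < 0 &
    (\bigcap_(c in rees_constraints `\ extend alpha (-1)) halfspace c) w.
Proof.
move=> Va; have [c cV] := vertex_exposed Va; have aQ := vertices_sub Va.
(* Moving from [alpha] along [e_i] stays in [Q], and [alpha] is the strict minimiser of [c]
   there. *)
have c0 i : 0 <= c 0 i.
  have := cV _ (covering_add_unit i aQ).
  rewrite innerDl ltrDl innerC inner_unit => /(_ _)/ltW; apply.
  by move=> /eqP; rewrite -subr_eq0 addrC addKr (negbTE (unit_vec_neq0 _)).
(* Raising the last coordinate above [inner alpha c] by at most the smallest of these gaps violates
   the half-space of [alpha] and no other. *)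
pose f (beta : 'rV[R]_n) := inner beta c - inner alpha c.
have [beta [Vb /eqP ba]|e e0 eV] := finite_pos_lower_bound (A := V `\ alpha) (f := f)
    (finite_setD _ finite_covering_vertices).
  by rewrite subr_gt0 cV //; [exact: vertices_sub|apply/eqP].
exists (extend c (inner alpha c + e)).
  by rewrite inner_extend innerC mulrN1; lra.
apply: rees_constraintsP => [|k _ _|_|beta Vb [_ ba]] //.
  by apply: addr_ge0; [apply: inner_ge0; case/coveringP: aQ|exact: ltW].
rewrite -lerBrDl innerC; apply: eV; split=> // bE; apply: ba.
by rewrite /= bE.
Qed.

Lemma rees_constraints_irredundant c : rees_constraints c ->
  exists2 w, inner w c < 0 &
    (\bigcap_(c' in rees_constraints `\ c) halfspace c') w.
Proof.
case=> [[_ [[i [j ij] <-]|->]]|[alpha Va]] <-.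
- apply: (@rees_constraints_lunit_irredundant i j).
  by rewrite -inner_unit innerC.
- exact: rees_constraints_runit_irredundant.
- exact: rees_constraints_vertex_irredundant.
Qed.

Lemma rees_cone_irreducible :
  irreducible_representation (rees_cone R v) rees_constraints.
Proof.
split; last 2 first.
- exact: rees_coneE.
- move=> c Cc eqC; have [w wc] := rees_constraints_irredundant Cc.
  rewrite -eqC rees_coneE => /(_ c Cc) /=.
  by rewrite /halfspace /= leNgt wc.
- rewrite finite_setU; split; apply: finite_image => //.
  exact: finite_covering_vertices.
(* A zero normal could not be negative on the witness of its own non-redundancy. *)
move=> c Cc; apply/eqP => c0.
have [w + _] := rees_constraints_irredundant Cc.
by rewrite c0 innerC inner0l ltxx.
Qed.

End ReesCone.

Theorem theorem3p2 (R : realType) (K : fieldType) (n q : nat)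
    (I : set {mpoly K[n]}) (v : 'I_q -> 'X_{1..n})
    (hq : (1 <= q)%N) (hI : minimally_generated I v) :
  let J := rees_index R v in
  let V := vertices (covering_polyhedron R v) in
  rees_cone R v =
    (\bigcap_(i in J) halfspace (unit_vec R i)) `&`
    (\bigcap_(alpha in V) halfspace (extend alpha (-1))) /\
  irreducible_representation (rees_cone R v)
    ([set unit_vec R i | i in J] `|` [set extend alpha (-1) | alpha in V]).
Proof.
split; last exact: rees_cone_irreducible.
by rewrite -rees_constraintsE rees_coneE.
Qed.
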